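(* Let $S$ be a multiplicative subsemigroup of $\mathbb{N}$. Then $\mathscr{H}^\infty_S$ is unital (that is, it contains the unit element $\mathbf{1}$ of $\mathscr{H}^\infty$) if and only if $1\in S$.
   Context: $\mathbb{N}=\{1,2,3,\dots\}$ and $\mathbb{C}_0=\{s\in\mathbb{C}:\operatorname{Re}(s)>0\}$. $\mathscr{H}^\infty$ is the set of all Dirichlet series $f=\sum_{n=1}^\infty a_n n^{-s}$ ($a_n\in\mathbb{C}$ for all $n\in\mathbb{N}$) that converge at each $s\in\mathbb{C}_0$ and satisfy $\|f\|_\infty:=\sup_{s\in\mathbb{C}_0}|f(s)|<\infty$. With pointwise operations and the norm $\|\cdot\|_\infty$, $\mathscr{H}^\infty$ is a Banach algebra, with unit element $\mathbf{1}=\sum_{n=1}^\infty\delta_{n1}n^{-s}$, where $\delta_{11}=1$ and $\delta_{n1}=0$ for $n\neq 1$ (the constant function $1$). For $S\subset\mathbb{N}$, $\mathscr{H}^\infty_S$ is the set of all $f=\sum_{n=1}^\infty a_n n^{-s}\in\mathscr{H}^\infty$ such that $a_n=0$ for all $n\in\mathbb{N}\setminus S$. A subset $S$ of $\mathbb{N}$ is a multiplicative subsemigroup of $\mathbb{N}$ if $s_1s_2\in S$ for all $s_1,s_2\in S$. *)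

(* Defs.v *)
From Stdlib Require Import Reals Lra Lia.
From Coquelicot Require Import Coquelicot.
Open Scope R_scope.

Definition C0 : Type := {s : C | 0 < Re s}.

Definition Cexp (z : C) : C := (exp (Re z) * cos (Im z), exp (Re z) * sin (Im z)).

Definition Cpow_nat (n : nat) (s : C) : C := Cexp (s * RtoC (ln (INR n)))%C.

(** [f] is the function on [C0] defined by the everywhere convergent Dirichlet
    series [sum_{n >= 1} a n * n^(-s)].  Coquelicot's series start at [0], hence
    the shift; the value [a 0] plays no role.  [is_series] is convergence of the
    ordered partial sums, not absolute convergence. *)
Definition is_Dirichlet (a : nat -> C) (f : C0 -> C) : Prop :=
  forall s : C0,
    is_series (fun k : nat => (a (S k) * Cpow_nat (S k) (- proj1_sig s))%C) (f s).

Definition norm_infty (f : C0 -> C) : Rbar :=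
  Lub_Rbar (fun x : R => exists s : C0, x = Cmod (f s)).

Definition Hinf (f : C0 -> C) : Prop :=
  (exists a : nat -> C, is_Dirichlet a f) /\ Rbar_lt (norm_infty f) p_infty.

Definition Hinf_sub (A : nat -> Prop) (f : C0 -> C) : Prop :=
  Hinf f /\
  exists a : nat -> C,
    is_Dirichlet a f /\ forall n : nat, (1 <= n)%nat -> ~ A n -> a n = RtoC 0.

Definition Hinf_one : C0 -> C := fun _ => RtoC 1.

Definition unital (B : (C0 -> C) -> Prop) : Prop := B Hinf_one.

(** The natural numbers start at [1], so a subset of them is a predicate on [nat]
    that fails at [0]. *)
Definition mult_subsemigroup (A : nat -> Prop) : Prop :=
  (forall n : nat, A n -> (1 <= n)%nat) /\
  (forall m n : nat, A m -> A n -> A (m * n)%nat).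

Definition delta1 (n : nat) : C := if Nat.eqb n 1 then RtoC 1 else RtoC 0.

Lemma Hinf_one_Dirichlet : is_Dirichlet delta1 Hinf_one.
Proof.
intros s. unfold is_series.
apply filterlim_ext with (fun _ : nat => RtoC 1).
2: apply filterlim_const.
assert (H0 : (delta1 1 * Cpow_nat 1 (- proj1_sig s))%C = RtoC 1).
{ unfold delta1, Cpow_nat, Cexp. simpl Nat.eqb. cbv iota.
  change (INR 1) with 1. rewrite ln_1, Cmult_0_r. unfold RtoC; simpl.
  rewrite exp_0, cos_0, sin_0.
  apply injective_projections; simpl; ring. }
induction x as [|n IH].
- rewrite sum_O. symmetry; exact H0.
- rewrite sum_Sn, <- IH. unfold delta1 at 1. simpl Nat.eqb. cbv iota.
  rewrite Cmult_0_l. symmetry. exact (Cplus_0_r (RtoC 1)).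
Qed.

Lemma Hinf_one_in : Hinf Hinf_one.
Proof.
split.
- exists delta1; exact Hinf_one_Dirichlet.
- apply Rbar_le_lt_trans with (Finite 1); [|exact I].
  unfold norm_infty.
  apply (proj2 (Lub_Rbar_correct (fun x : R => exists s : C0, x = Cmod (Hinf_one s)))).
  intros x [s ->]. unfold Hinf_one. rewrite Cmod_1. simpl; lra.
Qed.

Lemma Hinf_one_unit (f : C0 -> C) (s : C0) :
  (Hinf_one s * f s)%C = f s /\ (f s * Hinf_one s)%C = f s.
Proof. unfold Hinf_one; split; ring. Qed.

(* Main.v *)
(** If [f] is the sum of [a n * n^(-s)] on the half-plane, then the terms of the
    convergent series at [s = 1] are bounded, so [|a n| <= M n].  Comparison with
    the telescoping series of [1/(n (n+1))] then gives
    [|f (m+3) - a 1| <= M / 2^m], whence [a 1] is the limit of [f] at [+oo].  For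
    [f = 1] this forces [a 1 = 1], and in particular [a 1 <> 0]. *)

Require Import Defs.
From Stdlib Require Import Reals.
From Coquelicot Require Import Coquelicot.
From Stdlib Require Import Lra Lia Classical.

Definition posint_C0 (m : nat) : C0 :=
  exist (fun s : C => 0 < Re s) (RtoC (INR (S m))) (lt_0_INR (S m) (Nat.lt_0_succ m)).

(** At a real exponent the imaginary part is zero, so the cosine is 1, the sine is 0, and only a
    real power remains. *)
Lemma Cpow_nat_opp_INR (k m : nat) :
  Cpow_nat (S k) (- RtoC (INR m))%C = RtoC ((/ INR (S k)) ^ m).
Proof.
assert (Hk : 0 < INR (S k)) by (apply lt_0_INR; lia).
assert (E : (- RtoC (INR m) * RtoC (ln (INR (S k))))%C
            = RtoC (- (INR m * ln (INR (S k))))).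
{ rewrite <- RtoC_opp, <- RtoC_mult; f_equal; ring. }
unfold Cpow_nat, Cexp; rewrite E.
cbn [Re Im RtoC fst snd].
rewrite cos_0, sin_0, Rmult_0_r, Rmult_1_r, exp_Ropp.
change (exp (INR m * ln (INR (S k)))) with (Rpower (INR (S k)) (INR m)).
rewrite Rpower_pow by exact Hk.
now rewrite pow_inv.
Qed.

Lemma Cmod_Cpow_nat_opp_INR (k m : nat) :
  Cmod (Cpow_nat (S k) (- RtoC (INR m))%C) = (/ INR (S k)) ^ m.
Proof.
rewrite Cpow_nat_opp_INR, Cmod_R.
apply Rabs_pos_eq, pow_le, Rlt_le, Rinv_0_lt_compat, lt_0_INR; lia.
Qed.

(** Convergent partial sums are bounded, and each term after the first is the difference of two
    consecutive ones. *)
Lemma is_series_Cmod_terms_bounded (u : nat -> C) (l : C) :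
  is_series (K := C_AbsRing) (V := C_NormedModule) u l ->
  exists M : R, forall n : nat, Cmod (u n) <= M.
Proof.
intros H.
destruct (filterlim_bounded (K := C_AbsRing) (V := C_NormedModule)
            (sum_n (G := C_NormedModule) u) (ex_intro _ l H)) as [M HM].
change (forall n, Cmod (sum_n (G := C_NormedModule) u n) <= M) in HM.
exists (2 * M); intros [|n].
- assert (H0 := HM 0%nat); rewrite sum_O in H0.
  assert (H1 := Cmod_ge_0 (u 0%nat)); lra.
- assert (H0 := HM n); assert (H1 := HM (S n)); rewrite sum_Sn in H1.
  set (p := sum_n (G := C_NormedModule) u n) in *.
  change (Cmod (p + u (S n))%C <= M) in H1.
  replace (u (S n)) with ((p + u (S n)) + - p)%C by ring.
  eapply Rle_trans; [apply Cmod_triangle|].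
  rewrite Cmod_opp; lra.
Qed.

(** A closed disc contains the limits of its sequences. *)
Lemma is_series_Cmod_sub_le (u : nat -> C) (l c : C) (B : R) :
  is_series (K := C_AbsRing) (V := C_NormedModule) u l ->
  (forall n : nat, Cmod (sum_n (G := C_NormedModule) u n - c)%C <= B) ->
  Cmod (l - c)%C <= B.
Proof.
intros H HB.
assert (L : is_lim_seq (fun n => Cmod (sum_n (G := C_NormedModule) u n - c)%C)
              (Cmod (l - c)%C)).
{ apply (filterlim_comp _ _ _ (fun n => (sum_n (G := C_NormedModule) u n - c)%C) Cmod
           _ (locally (T := C_NormedModule) (l - c)%C)).
  - exact (filterlim_comp_2 _ _ _ H (filterlim_const (- c)%C)
             (filterlim_plus (K := C_AbsRing) (V := C_NormedModule) l (- c)%C)).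
  - exact (filterlim_norm (K := C_AbsRing) (V := C_NormedModule) (l - c)%C). }
exact (is_lim_seq_le _ _ _ _ HB L (is_lim_seq_const B)).
Qed.

Lemma Dirichlet_sub_leading_coeff_le (a : nat -> C) (f : C0 -> C) :
  is_Dirichlet a f ->
  exists M : R, forall m : nat,
    Cmod (f (posint_C0 (m + 2)) - a 1%nat)%C <= M * (/ 2) ^ m.
Proof.
intros H.
(* [posint_C0] shifts its index by one: this is the point 1, and [posint_C0 (m + 2)] is the point
   [m + 3]. *)
destruct (is_series_Cmod_terms_bounded _ _ (H (posint_C0 0))) as [M HM].
assert (HM' : forall k, Cmod (a (S k)) * / INR (S k) <= M).
{ intros k; assert (Hk := HM k); cbn [posint_C0 proj1_sig] in Hk.
  rewrite Cmod_mult, Cmod_Cpow_nat_opp_INR, pow_1 in Hk; exact Hk. }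
assert (M0 : 0 <= M).
{ apply Rle_trans with (2 := HM 0%nat), Cmod_ge_0. }
exists M; intros m.
assert (B0 : 0 <= M * (/ 2) ^ m).
{ apply Rmult_le_pos; [exact M0|apply pow_le; lra]. }
apply (is_series_Cmod_sub_le _ _ _ _ (H (posint_C0 (m + 2)))).
cbn [posint_C0 proj1_sig].
intros n.
(* The bound with the telescoping remainder is what the induction needs. *)
apply Rle_trans with (M * (/ 2) ^ m * (1 - / INR (S n))).
2: { assert (0 < / INR (S n)) by (apply Rinv_0_lt_compat, lt_0_INR; lia); nra. }
induction n as [|n IH].
(* The first partial sum is exactly [a 1], which matches the factor [1 - / 1 = 0]. *)
- rewrite sum_O, Cpow_nat_opp_INR.
  change (INR 1) with 1; rewrite Rinv_1, pow1, Cmult_1_r.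
  replace (a 1%nat - a 1%nat)%C with (RtoC 0) by ring.
  rewrite Cmod_0; lra.
- rewrite sum_Sn.
  set (p := sum_n _ n) in *.
  set (t := (a (S (S n)) * _)%C).
  change (plus p t) with (p + t)%C.
  replace (p + t - a 1%nat)%C with ((p - a 1%nat) + t)%C by ring.
  eapply Rle_trans; [apply Cmod_triangle|].
  (* Of the [m + 3] factors [/ INR (S (S n))], one turns the coefficient into at most [M], [m] of
     them are each at most [/ 2], and two are kept for the telescoping. *)
  assert (T : Cmod t <= M * (/ 2) ^ m * (/ INR (S (S n))) ^ 2).
  { unfold t; rewrite Cmod_mult, Cmod_Cpow_nat_opp_INR.
    assert (Hn := HM' (S n)).
    set (q := / INR (S (S n))) in *.
    assert (q0 : 0 < q) by (apply Rinv_0_lt_compat, lt_0_INR; lia).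
    assert (q2 : q <= / 2).
    { apply Rinv_le_contravar; [lra|].
      rewrite !S_INR; assert (H0 := pos_INR n); lra. }
    replace (S (m + 2)) with (1 + (m + 2))%nat by lia.
    rewrite !pow_add, pow_1, <- !Rmult_assoc.
    apply Rmult_le_compat_r; [apply pow_le; lra|].
    apply Rmult_le_compat; [| apply pow_le; lra | exact Hn | apply pow_incr; lra].
    apply Rmult_le_pos; [apply Cmod_ge_0|lra]. }
  assert (Q : (/ INR (S (S n))) ^ 2 <= / INR (S n) - / INR (S (S n))).
  { assert (H0 : 0 < INR (S n)) by (apply lt_0_INR; lia).
    rewrite (S_INR (S n)).
    set (x := INR (S n)) in *.
    assert (E : / x - / (x + 1) - (/ (x + 1)) ^ 2 = / (x * (x + 1) ^ 2))
      by (field; lra).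
    assert (0 < / (x * (x + 1) ^ 2))
      by (apply Rinv_0_lt_compat, Rmult_lt_0_compat; [lra|apply pow_lt; lra]).
    lra. }
  assert (R := Rmult_le_compat_l _ _ _ B0 Q).
  lra.
Qed.

Lemma Dirichlet_one_leading_coeff_neq_0 (a : nat -> C) :
  is_Dirichlet a Hinf_one -> a 1%nat <> RtoC 0.
Proof.
intros H Ha.
destruct (Dirichlet_sub_leading_coeff_le _ _ H) as [M HM].
assert (L : is_lim_seq (fun m => M * (/ 2) ^ m) (M * 0)).
{ apply (is_lim_seq_scal_l _ M 0), is_lim_seq_geom.
  rewrite Rabs_pos_eq; lra. }
(* With [a 1 = 0] the left-hand side of the estimate is constantly 1, while its right-hand side
   tends to 0. *)
assert (H1 : forall m : nat, 1 <= M * (/ 2) ^ m).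
{ intros m; assert (Hm := HM m); unfold Hinf_one in Hm.
  replace (RtoC 1 - a 1%nat)%C with (RtoC 1) in Hm by (rewrite Ha; ring).
  now rewrite Cmod_1 in Hm. }
assert (C := is_lim_seq_le _ _ _ _ H1 (is_lim_seq_const 1) L).
simpl in C; lra.
Qed.

Theorem proposition2p2 (A : nat -> Prop) (hA : mult_subsemigroup A) :
  unital (Hinf_sub A) <-> A 1%nat.
Proof.
split.
- intros [_ [a [Ha H0]]].
  (* [A] need not be decidable, so the argument is classical: if 1 were outside [A], the support
     condition would force [a 1 = 0]. *)
  apply NNPP; intros HA.
  exact (Dirichlet_one_leading_coeff_neq_0 a Ha (H0 1%nat (le_n 1) HA)).
- intros HA; split; [exact Hinf_one_in|].
  exists delta1; split; [exact Hinf_one_Dirichlet|].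
  intros n _ Hn; unfold delta1.
  destruct (Nat.eqb_spec n 1) as [->|_]; [contradiction|reflexivity].
Qed.
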